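(* Let $T\in\mathfrak{P}_n$ and suppose that $T$ has a completion in $H(\mathfrak{C}_n)$. Then the group $[\mathcal{F}(T),\mathcal{F}(T)]$ (the derived subgroup of $\mathcal{F}(T)$) is simple.
   Context: $n\ge2$, $X_n=\{0,\dots,n-1\}$, $X_n^*$ is the set of finite words, $\epsilon$ the empty word, $\mathfrak{C}_n=X_n^\omega$ is Cantor space, $H(\mathfrak{C}_n)$ its homeomorphism group. Functions act on the right. A maximal antichain of $X_n^*$ is a finite set of words $\eta$ whose cones $[\eta]=\eta\mathfrak{C}_n$ partition $\mathfrak{C}_n$. A transducer $T=\langle X_n,Q,\pi,\lambda\rangle$ consists of a finite state set $Q$ and functions $\pi:X_n\times Q\to Q$, $\lambda:X_n\times Q\to X_n^*$, extended to words by $\pi(\epsilon,q)=q$, $\lambda(\epsilon,q)=\epsilon$, $\pi(xw,q)=\pi(w,\pi(x,q))$, $\lambda(xw,q)=\lambda(x,q)\lambda(w,\pi(x,q))$ (and $\lambda$ likewise to infinite words). For a state $q$, $T_q$ is the map $\mathfrak{C}_n\to\mathfrak{C}_n$, $\delta\mapsto\lambda(\delta,q)$ (outputs on infinite words being infinite), and $\mathrm{im}(q)$ is its image. $T$ is partially invertible if for every state $q$ the map $T_q$ is injective and has clopen image; $\mathfrak{P}_n$ is the set of partially invertible transducers over $X_n$. For $T\in\mathfrak{P}_n$, a viable combination is a pair of tuples $((\rho_1,\dots,\rho_l),(p_1,\dots,p_l))$ of (not necessarily distinct or incomparable) words $\rho_i\in X_n^*$ and (not necessarily distinct) states $p_i$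 such that $\bigcup_i\rho_i\,\mathrm{im}(p_i)=\mathfrak{C}_n$ and $\rho_i\,\mathrm{im}(p_i)\cap\rho_j\,\mathrm{im}(p_j)=\emptyset$ for $i\ne j$. If $l\equiv1\pmod{n-1}$, then for any maximal antichain $\{\eta_1,\dots,\eta_l\}$ of $X_n^*$ the homeomorphism $h$ of $\mathfrak{C}_n$ with $(\eta_i\chi)h=\rho_i(\chi)T_{p_i}$ (all $i$, $\chi\in\mathfrak{C}_n$) is called a completion of $T$ in $H(\mathfrak{C}_n)$. $\mathcal{H}(T)$ is the subgroup of $H(\mathfrak{C}_n)$ generated by all completions of $T$ in $H(\mathfrak{C}_n)$. A homeomorphism $h$ of a space $X$ locally agrees with a group $G$ of homeomorphisms of $X$ if for every $x\in X$ there are an open neighbourhood $U$ of $x$ and $g\in G$ with $h|_U=g|_U$. For $T\in\mathfrak{P}_n$ having a completion in $H(\mathfrak{C}_n)$, $\mathcal{F}(T)$ is the group of all homeomorphisms of $\mathfrak{C}_n$ which locally agree with $\mathcal{H}(T)$. *)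

(* Defs.v *)
From HB Require Import structures.
From mathcomp Require Import all_boot all_classical topology.

Set Implicit Arguments.
Unset Strict Implicit.
Unset Printing Implicit Defensive.

Import Algebra.
Local Open Scope classical_set_scope.
Local Open Scope group_scope.

Section Subgroups.
Variable G : groupType.
Implicit Types H N S : set G.

Definition is_subgroup H : Prop := group_closed (mem H).

Definition generated S : set G := smallest is_subgroup S.

Definition derived H : set G :=
  generated [set [~ x, y] | x in H & y in H].

Definition normal_in N H : Prop :=
  [/\ is_subgroup N, N `<=` H & forall x y, N x -> H y -> N (x ^ y)].

Definition simple_subgroup H : Prop :=
  [/\ is_subgroup H, H <> [set 1]
    & forall N, normal_in N H -> N = [set 1] \/ N = H].

End Subgroups.

Record homeo (X : topologicalType) := Homeo {
  homeo_fun :> X -> X;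
  homeo_inv : X -> X;
  homeoK : cancel homeo_fun homeo_inv;
  homeoVK : cancel homeo_inv homeo_fun;
  homeo_continuous : continuous homeo_fun;
  homeoV_continuous : continuous homeo_inv }.

Section HomeoGroup.
Variable X : topologicalType.
Implicit Types h k : homeo X.

Lemma homeo_ext h k : h =1 k -> h = k.
Proof.
case: h k => [f f' fK f'K fc f'c] [g g' gK g'K gc g'c] /= /funext fg; subst g.
have f'g' : f' = g' by apply/funext => x; rewrite -{1}[x]g'K fK.
by subst g'; congr Homeo; exact: Prop_irrelevance.
Qed.

Definition homeo_one : homeo X :=
  @Homeo X idfun idfun (fun=> erefl) (fun=> erefl)
    (fun _ => cvg_id) (fun _ => cvg_id).

(* Functions act on the right: [homeo_mul h k] is [h] followed by [k]. *)
Definition homeo_mul h k : homeo X :=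
  @Homeo X (k \o h) (homeo_inv h \o homeo_inv k)
    (can_comp (@homeoK _ k) (@homeoK _ h))
    (can_comp (@homeoVK _ h) (@homeoVK _ k))
    (fun x => continuous_comp (@homeo_continuous _ h x)
                              (@homeo_continuous _ k (h x)))
    (fun x => continuous_comp (@homeoV_continuous _ k x)
                              (@homeoV_continuous _ h (homeo_inv k x))).

Definition homeo_invg h : homeo X :=
  @Homeo X (homeo_inv h) h (@homeoVK _ h) (@homeoK _ h)
    (@homeoV_continuous _ h) (@homeo_continuous _ h).

HB.instance Definition _ := gen_eqMixin (homeo X).
HB.instance Definition _ := gen_choiceMixin (homeo X).

Let homeo_mulA : associative homeo_mul.
Proof. by move=> h k l; exact: homeo_ext. Qed.
Let homeo_mul1 : left_id homeo_one homeo_mul.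
Proof. by move=> h; exact: homeo_ext. Qed.
Let homeo_mulr1 : right_id homeo_one homeo_mul.
Proof. by move=> h; exact: homeo_ext. Qed.
Let homeo_mulV : left_inverse homeo_one homeo_invg homeo_mul.
Proof. by move=> h; apply: homeo_ext => x /=; exact: homeoVK. Qed.
Let homeo_mulrV : right_inverse homeo_one homeo_invg homeo_mul.
Proof. by move=> h; apply: homeo_ext => x /=; exact: homeoK. Qed.

HB.instance Definition _ := isGroup.Build (homeo X)
  homeo_mulA homeo_mul1 homeo_mulr1 homeo_mulV homeo_mulrV.

Definition locally_agrees (G : set (homeo X)) h : Prop :=
  forall x, exists U g, [/\ open U, U x, G g & {in U, h =1 g}].

End HomeoGroup.

Definition cantor (n : nat) : Type :=
  prod_topology (fun _ : nat => discrete_topology 'I_n).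

HB.instance Definition _ n := Topological.on (cantor n).

Section Words.
Variable n : nat.
Implicit Types (w : seq 'I_n) (d : cantor n).

(* The infinite word [w d]: the default value of [nth] is the letter that [d]
   contributes at position [i] once [w] is exhausted. *)
Definition wcat w d : cantor n := fun i => nth (d (i - size w)) w i.

Definition cone w : set (cantor n) := range (wcat w).

Definition wprefix d (m : nat) : seq 'I_n := mkseq d m.

(* An enumeration of a maximal antichain: the [eta i] are distinct, since their
   cones are disjoint and (for [0 < n]) nonempty. *)
Definition maximal_antichain (l : nat) (eta : 'I_l -> seq 'I_n) : Prop :=
  \bigcup_i cone (eta i) = setT /\ trivIset setT (cone \o eta).

End Words.

Section Extension.
Variables (n : nat) (Q : Type).
Variables (pi : 'I_n -> Q -> Q) (lambda : 'I_n -> Q -> seq 'I_n).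

Fixpoint word_next (w : seq 'I_n) (q : Q) : Q :=
  if w is x :: w' then word_next w' (pi x q) else q.

Fixpoint word_out (w : seq 'I_n) (q : Q) : seq 'I_n :=
  if w is x :: w' then lambda x q ++ word_out w' (pi x q) else [::].

End Extension.

(* The last field says that reading an infinite word yields an infinite output:
   for every position [i], some finite prefix already outputs more than [i]
   letters. *)
Record transducer (n : nat) := Transducer {
  state : finType;
  next : 'I_n -> state -> state;
  out : 'I_n -> state -> seq 'I_n;
  out_infinite : forall (q : state) (d : cantor n) (i : nat),
    exists m, i < size (word_out next out (wprefix d m) q) }.

Section Transducers.
Variables (n : nat) (T : transducer n).

(* The map T_q. Letter [i] is read off the output on the shortest prefix of [d]
   producing more than [i] letters (so [d 0] is never used); longer prefixes
   only extend this output. *)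
Definition state_map (q : state T) (d : cantor n) : cantor n := fun i =>
  nth (d 0) (word_out (@next n T) (@out n T)
              (wprefix d (ex_minn (out_infinite q d i))) q) i.

Definition im (q : state T) : set (cantor n) := range (state_map q).

Definition partially_invertible : Prop :=
  forall q : state T, injective (state_map q) /\ clopen (im q).

Definition viable (l : nat) (rho : 'I_l -> seq 'I_n) (p : 'I_l -> state T) :=
  let piece i := wcat (rho i) @` im (p i) in
  \bigcup_i piece i = setT /\ trivIset setT piece.

Definition completion : set (homeo (cantor n)) := [set h |
  exists l (rho : 'I_l -> seq 'I_n) (p : 'I_l -> state T)
           (eta : 'I_l -> seq 'I_n),
    [/\ viable rho p, l = 1 %[mod n.-1], maximal_antichain eta
      & forall i (x : cantor n),
          h (wcat (eta i) x) = wcat (rho i) (state_map (p i) x)]].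

Definition completion_group : set (homeo (cantor n)) := generated completion.

Definition full_group : set (homeo (cantor n)) :=
  [set h | locally_agrees completion_group h].

End Transducers.

(* Main.v *)
Require Import Defs.
From mathcomp Require Import all_boot all_classical topology.

(** Write F for the full group of T. Its derived subgroup is simple because F is
    compressible: any clopen set A can be moved into any disjoint nonempty
    clopen set B by an element of F supported in the union of A and B
    ([full_group_compressible]).

    For compressibility, start from a completion h. The recursion
    T_q(x d) = out(x, q) T_q'(d), with q' the state after reading x, splits the
    pieces of h further, so h has presentations with k (n - 1) + 1 pieces for
    every large k ([presents_long]). The pieces of one presentation can be laid
    out along any maximal antichain of the same size, which gives another
    completion; two of these differ by a prefix replacement. Choosing antichains
    that contain y and ay at the same position shows that d |-> a d agrees, near
    every infinite word beginning with y, with an element of the group generated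
    by the completions ([prepend_letter_agrees]). Hence d |-> w d locally agrees
    with F for every word w. As F is full, the involution that exchanges A with
    wA through this map belongs to F; take w with its cone contained in B.

    The rest holds for any full compressible group F of homeomorphisms of a
    nonempty perfect zero-dimensional space ([full_derived_simple]). Let M be
    the group generated by the commutators of elements of F that have a common
    proper clopen support.
    - Conjugating an element of F by another one with the same proper clopen
      support changes it by an element of M, and every nontrivial element of F
      is a product of two elements with proper clopen support. By
      compressibility, every element of F is therefore, modulo M, supported in
      any prescribed nonempty clopen set ([full_mod]). Thus M = [F, F], and
      [F, F] moves any proper clopen set into any nonempty clopen set
      ([derived_move]).
    - If N is normal in [F, F] and contains some g <> 1, a double commutator
      with g shows that N contains the commutators of all elements of F
      supported in some nonempty clopen U ([normal_rigid_commutators]).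
      Conjugating by [F, F], N contains the generators of M, so N = [F, F]. *)

Set Implicit Arguments.
Unset Strict Implicit.
Unset Printing Implicit Defensive.

Import Algebra.

(** * Generated subgroups *)

Section GeneratedSubgroups.
Local Open Scope classical_set_scope.
Local Open Scope group_scope.
Variable G : groupType.
Implicit Types (H M N S : set G) (c u v x y z : G).

Lemma is_subgroupP H :
  is_subgroup H <-> H 1 /\ forall x y, H x -> H y -> H (x * y^-1).
Proof.
split=> [[H1 HV]|[H1 HV]].
  split; first by move/set_mem: H1.
  by move=> x y Hx Hy; apply: set_mem; apply: HV; apply: mem_set.
split; first exact: mem_set.
by move=> x y /set_mem Hx /set_mem Hy; apply: mem_set; exact: HV.
Qed.

Lemma subgroup1 H : is_subgroup H -> H 1.
Proof. by case/is_subgroupP. Qed.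

Lemma subgroupV H x : is_subgroup H -> H x -> H x^-1.
Proof. by case/is_subgroupP=> H1 HV Hx; rewrite -[x^-1]mul1g; exact: HV. Qed.

Lemma subgroupM H x y : is_subgroup H -> H x -> H y -> H (x * y).
Proof.
move=> sH Hx Hy; rewrite -[y]invgK; move/is_subgroupP: (sH) => [_]; apply=> //.
exact: subgroupV.
Qed.

Lemma subgroupJ H x y : is_subgroup H -> H x -> H y -> H (x ^ y).
Proof.
move=> sH Hx Hy; rewrite conjgE.
by apply: subgroupM=> //; [exact: subgroupV|exact: subgroupM].
Qed.

Lemma subgroupR H x y : is_subgroup H -> H x -> H y -> H [~ x, y].
Proof.
move=> sH Hx Hy; rewrite commgEl.
by apply: subgroupM=> //; [exact: subgroupV|exact: subgroupJ].
Qed.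

Lemma generated_subgroup S : is_subgroup (generated S).
Proof.
apply/is_subgroupP; split=> [H [sH _]|x y Sx Sy H HS]; first exact: subgroup1.
have [sH _] := HS; apply: subgroupM => //; first exact: Sx.
by apply: subgroupV => //; exact: Sy.
Qed.

Lemma sub_generated S : S `<=` generated S.
Proof. exact: sub_gen_smallest. Qed.

Lemma generated_sub S H : is_subgroup H -> S `<=` H -> generated S `<=` H.
Proof. exact: smallest_sub. Qed.

Lemma generated_conj S z :
    (forall x, S x -> S (x ^ z)) ->
  forall x, generated S x -> generated S (x ^ z).
Proof.
move=> Sz; apply: (@generated_sub S [set x | generated S (x ^ z)]).
  have sS := generated_subgroup S.
  apply/is_subgroupP; split=> [|x y /= Sx Sy].
    by rewrite /= conj1g; exact: (subgroup1 sS).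
  rewrite /= conjMg conjVg.
  by apply: (subgroupM sS)=> //; exact: (subgroupV sS).
by move=> x Sx; apply: sub_generated; exact: Sz.
Qed.

Lemma derivedR H x y : H x -> H y -> derived H [~ x, y].
Proof. by move=> Hx Hy; apply: sub_generated; exists x => //; exists y. Qed.

Lemma derived_sub H : is_subgroup H -> derived H `<=` H.
Proof.
by move=> sH; apply: generated_sub=> // _ [x Hx] [y Hy] <-; exact: subgroupR.
Qed.

Lemma commMgJ x y z : [~ x * y, z] = [~ x, z] ^ y * [~ y, z].
Proof. by rewrite /commg /conjg !invgM !mulgA !mulgK. Qed.

Lemma invg_commg x y : [~ x, y]^-1 = [~ y, x].
Proof. by rewrite /commg /conjg !invgM !invgK !mulgA. Qed.

Lemma conjg_split x y : x = [~ x^-1, y] * x ^ y.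
Proof. by rewrite commgEl invgK conjVg mulgVK. Qed.

(** An element of a subgroup normalised by [H] can be dropped when a commutator
    is computed modulo that subgroup. *)
Lemma commg_mod M H x y z :
    is_subgroup M -> (forall u v, M u -> H v -> M (u ^ v)) ->
    is_subgroup H -> H y -> H z -> M x ->
  M [~ y, z] -> M [~ x * y, z].
Proof.
move=> sM MH sH Hy Hz Mx Myz; rewrite commMgJ; apply: subgroupM => //.
apply: (MH) => //; rewrite commgEl; apply: subgroupM => //.
  exact: subgroupV.
exact: MH.
Qed.

(** A factor that commutes with the other argument drops out of a commutator. *)
Lemma commg_dropl c u v : commute c v -> [~ c * u, v] = [~ u, v].
Proof.
by move=> /commgP/eqP cv; rewrite commMgJ cv conj1g mul1g.
Qed.

Lemma commg_dropr c u v : commute c u -> [~ u, c * v] = [~ u, v].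
Proof. by move=> cu; rewrite -invg_commg commg_dropl// invg_commg. Qed.

End GeneratedSubgroups.

(** * Homeomorphisms, supports, and full groups *)

Section Supports.
Local Open Scope classical_set_scope.
Local Open Scope group_scope.
Variable X : topologicalType.
Implicit Types (A B C : set X) (f g h : homeo X) (F : set (homeo X)).

Lemma homeoM f g x : (f * g) x = g (f x). Proof. by []. Qed.

Lemma homeoKV f x : f^-1 (f x) = x. Proof. exact: homeoK. Qed.
Lemma homeoVKV f x : f (f^-1 x) = x. Proof. exact: homeoVK. Qed.

Lemma homeo_inj f : injective f. Proof. exact: can_inj (@homeoK _ f). Qed.

Lemma homeoJ f g x : (f ^ g) x = g (f (g^-1 x)). Proof. by []. Qed.

Lemma preimage_homeo_clopen f A : clopen A -> clopen (f @^-1` A).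
Proof. by move=> cA; apply: preimage_clopen=> //; exact: homeo_continuous. Qed.

(** [f] fixes every point outside [A]. *)
Definition supported A f := forall x, ~ A x -> f x = x.

Lemma supported_stable A f x : supported A f -> A x -> A (f x).
Proof.
move=> fA Ax; apply: contrapT => nA; have /homeo_inj fx := fA _ nA.
by apply: nA; rewrite fx.
Qed.

Lemma supported1 A : supported A 1. Proof. by []. Qed.

Lemma supportedV A f : supported A f -> supported A f^-1.
Proof. by move=> fA x /fA fx; rewrite -{1}fx homeoKV. Qed.

Lemma supportedM A f g : supported A f -> supported A g -> supported A (f * g).
Proof. by move=> fA gA x nA; rewrite homeoM fA// gA. Qed.

Lemma supportedS A B f : A `<=` B -> supported A f -> supported B f.
Proof. by move=> AB fA x nB; apply: fA => /AB. Qed.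

Lemma supportedJ A B f g :
  (forall x, A x -> B (g x)) -> supported A f -> supported B (f ^ g).
Proof.
move=> AB fA x nB; rewrite homeoJ fA ?homeoVKV// => /AB; rewrite homeoVKV.
exact: nB.
Qed.

Lemma commute_supported A B f g :
    (forall x, A x -> ~ B x) -> supported A f -> supported B g ->
  commute f g.
Proof.
move=> AB fA gB; apply: homeo_ext => x; rewrite !homeoM.
have [Ax|nA] := pselect (A x).
  rewrite (gB x)//; last exact: AB.
  by rewrite gB//; apply: AB; exact: supported_stable.
rewrite (fA x)//; have [Bx|nB] := pselect (B x).
  by rewrite fA// => /AB; apply; exact: supported_stable.
by rewrite gB// fA.
Qed.

(** The pointwise form of local agreement, for maps which need not be
    homeomorphisms. *)
Definition agrees_at F (phi : X -> X) x :=
  exists U g, [/\ open U, U x, F g & {in U, phi =1 g}].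

Lemma agrees_at_continuous F phi x :
  agrees_at F phi x -> {for x, continuous phi}.
Proof.
move=> [U [g [oU Ux _ phig]]]; rewrite /prop_for /continuous_at.
rewrite phig ?inE//; apply: cvg_trans (@homeo_continuous _ g x).
apply: near_eq_cvg; near=> y; apply/esym/phig; rewrite inE; near: y.
exact: open_nbhs_nbhs.
Unshelve. all: by end_near. Qed.

Lemma agrees_at_eq F phi psi A x :
    open A -> A x -> (forall y, A y -> phi y = psi y) ->
  agrees_at F phi x -> agrees_at F psi x.
Proof.
move=> oA Ax phipsi [U [g [oU Ux Fg phig]]].
exists (A `&` U), g; split=> //; first exact: openI.
by move=> y /set_mem [Ay Uy]; rewrite -phipsi// phig// inE.
Qed.

Lemma agrees_at_comp F phi psi x :
    is_subgroup F -> agrees_at F phi x -> agrees_at F psi (phi x) ->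
  agrees_at F (psi \o phi) x.
Proof.
move=> sF [U [g [oU Ux Fg phig]]] [V [h [oV Vx Fh psih]]].
exists (U `&` g @^-1` V), (g * h); split.
- apply: openI => //; apply: open_comp oV => // y _; exact: homeo_continuous.
- by split=> //=; rewrite -phig ?inE.
- exact: subgroupM.
- by move=> y /set_mem [Uy Vy]; rewrite /= phig ?inE// psih// inE.
Qed.

(** The local inverse of a map that agrees with [F] agrees with [F]. *)
Lemma agrees_at_inv F phi psi A B x :
    is_subgroup F -> open A -> open B ->
    (forall y, B y -> A (psi y)) -> (forall y, B y -> phi (psi y) = y) ->
    (forall y, A y -> psi (phi y) = y) ->
  B x -> agrees_at F phi (psi x) -> agrees_at F psi x.
Proof.
move=> sF oA oB BA phiK psiK Bx [U [g [oU Ux Fg phig]]].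
have gVpsi : homeo_inv g x = psi x.
  by rewrite -{1}(phiK _ Bx) phig ?inE//; last exact: homeoK.
exists (homeo_inv g @^-1` (A `&` U)), (g^-1)%g; split.
- apply: open_comp; last exact: openI.
  by move=> y _; exact: (@homeo_continuous _ (g^-1)%g).
- by rewrite /= gVpsi; split=> //; exact: BA.
- exact: subgroupV.
- move=> y /set_mem [Ay Uy].
  by rewrite -{1}(homeoVKV g y) -phig ?inE// psiK.
Qed.

(** A full group contains every homeomorphism that locally agrees with it. *)
Definition full F := forall h, locally_agrees F h -> F h.

(** Two disjoint clopen sets can be exchanged inside a full group along any
    bijection that locally agrees with the group. The exchanging map is an
    involution, so it is its own continuous inverse. *)
Lemma full_exchange F A B phi psi :
    is_subgroup F -> full F -> clopen A -> clopen B ->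
    (forall x, A x -> ~ B x) ->
    (forall x, A x -> B (phi x)) -> (forall x, B x -> A (psi x)) ->
    (forall x, A x -> psi (phi x) = x) -> (forall x, B x -> phi (psi x) = x) ->
    (forall x, A x -> agrees_at F phi x) ->
  exists s, [/\ F s, supported (A `|` B) s, forall x, A x -> s x = phi x
              & forall x, B x -> s x = psi x].
Proof.
move=> sF fullF [oA cA] [oB cB] AB phiAB psiBA phiK psiK phiF.
pose s x := if x \in A then phi x else if x \in B then psi x else x.
have sA x : A x -> s x = phi x by move=> Ax; rewrite /s mem_set.
have sB x : B x -> s x = psi x.
  move=> Bx; rewrite /s memNset ?mem_set// => /AB; exact.
have sN x : ~ (A `|` B) x -> s x = x.
  by move=> nAB; rewrite /s !memNset// => ?; apply: nAB; [right|left].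
have sK x : s (s x) = x.
  have [Ax|nA] := pselect (A x).
    by rewrite (sA x)// sB ?phiK//; exact: phiAB.
  have [Bx|nB] := pselect (B x).
    by rewrite (sB x)// sA ?psiK//; exact: psiBA.
  by rewrite sN ?sN//; case.
have sF' x : agrees_at F s x.
  have [Ax|nA] := pselect (A x).
    by apply: (agrees_at_eq oA Ax) (phiF _ Ax) => y Ay; rewrite sA.
  have [Bx|nB] := pselect (B x).
    apply: (agrees_at_eq oB Bx (phi := psi)) => [y By|]; first by rewrite sB.
    exact: (agrees_at_inv sF oA oB psiBA psiK phiK Bx (phiF _ (psiBA _ Bx))).
  have oN : open (~` (A `|` B)).
    by apply: closed_openC; exact: closedU.
  have Nx : (~` (A `|` B)) x by move=> [].
  exists (~` (A `|` B)), 1; split=> //; first exact: subgroup1.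
  by move=> y /set_mem Ny; exact: sN.
have sc : continuous s by move=> x; apply: agrees_at_continuous (sF' x).
by exists (@Homeo X s s sK sK sc sc); split=> //; apply: fullF => x; exact: sF'.
Qed.

Lemma locally_agrees_subgroup F :
  is_subgroup F -> is_subgroup [set h | locally_agrees F h].
Proof.
move=> sF; apply/is_subgroupP; split=> [x|f g fF gF x].
  by exists setT, 1; split=> //; [exact: openT|exact: subgroup1].
have gF' : agrees_at F (homeo_inv g) (f x).
  apply: (@agrees_at_inv F g _ setT setT) (gF _) => //; try exact: openT.
    by move=> y _; exact: homeoVK.
  by move=> y _; exact: homeoK.
exact: agrees_at_comp (fF x) gF'.
Qed.

Lemma locally_agrees_full F :
  is_subgroup F -> full [set h | locally_agrees F h].
Proof.
move=> sF h hF x; have [U [g [oU Ux gF hg]]] := hF x.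
apply: (@agrees_at_eq F g h U x oU Ux _ (gF x)) => y Uy.
by rewrite hg// inE.
Qed.

End Supports.

(** * Full compressible groups have simple derived subgroup *)

Section DerivedSimple.
Local Open Scope classical_set_scope.
Local Open Scope group_scope.
Variable X : topologicalType.
Implicit Types (A B C W Z : set X) (f g h k : homeo X).

(** Every clopen set can be moved into any disjoint nonempty clopen set, without
    disturbing the rest of the space. *)
Definition compressible (F : set (homeo X)) :=
  forall A B, clopen A -> clopen B -> (forall x, A x -> ~ B x) -> B !=set0 ->
  exists g, [/\ F g, supported (A `|` B) g & forall x, A x -> B (g x)].

(** The rigid stabiliser: elements of [F] that only move points of [A]. *)
Definition rigid (F : set (homeo X)) A : set (homeo X) :=
  [set f | F f /\ supported A f].

(** Commutators of elements with a common proper clopen support. *)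
Definition local_commutators (F : set (homeo X)) : set (homeo X) :=
  [set c | exists W f g, [/\ clopen W, ~` W !=set0, rigid F W f, rigid F W g
                          & c = [~ f, g]]].

Variable F : set (homeo X).
Hypotheses (sF : is_subgroup F) (fullF : full F) (cF : compressible F).
Hypotheses (zdX : zero_dimensional X) (pX : perfect_set [set: X]).

Let M := generated (local_commutators F).

Lemma rigid_subgroup A : is_subgroup (rigid F A).
Proof.
apply/is_subgroupP; split=> [|f g [Ff fA] [Fg gA]].
  by split; [exact: subgroup1|exact: supported1].
split; first by apply: subgroupM=> //; exact: subgroupV.
by apply: supportedM=> //; exact: supportedV.
Qed.

Lemma rigidS A B : A `<=` B -> rigid F A `<=` rigid F B.
Proof. by move=> AB f [Ff fA]; split=> //; exact: supportedS fA. Qed.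

Lemma rigidJ A B f g :
  (forall x, A x -> B (g x)) -> F g -> rigid F A f -> rigid F B (f ^ g).
Proof.
by move=> AB Fg [Ff fA]; split; [exact: subgroupJ|exact: supportedJ fA].
Qed.

(** A nonempty clopen set has a nonempty clopen subset that misses a given point
    and is not the whole set. *)
Lemma clopen_split C z : clopen C -> C !=set0 ->
  exists C', [/\ clopen C', C' !=set0, C' `<=` C, ~ C' z
               & (C `\` C') !=set0].
Proof.
move=> cC [x Cx].
have two y : C y -> exists2 y', C y' & y' != y.
  move=> Cy; apply: contrapT => none; have /perfectTP/(_ y) := pX; apply.
  suff -> : [set y] = C by case: cC.
  apply/seteqP; split=> [_ ->//|y' Cy']; apply: contrapT => /eqP ny.
  by apply: none; exists y'.
have cut y u : C y -> C u -> y != u -> (C z -> u = z) ->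
    exists C', [/\ clopen C', C' !=set0, C' `<=` C, ~ C' z
               & (C `\` C') !=set0].
  move=> Cy Cu yu uz; have [U [cU Uy nUu]] := zdX yu.
  exists (C `&` U); split.
  - exact: clopenI.
  - by exists y.
  - by move=> ? [].
  - by move=> [Cz Uz]; apply: nUu; rewrite uz.
  - by exists u; split=> // -[].
have [Cz|nCz] := pselect (C z).
  by have [y Cy yz] := two _ Cz; apply: (cut y z).
by have [y Cy yx] := two _ Cx; apply: (cut y x).
Qed.

(** A nontrivial homeomorphism moves some nonempty clopen set off itself. *)
Lemma displaced_clopen f : f <> 1 ->
  exists U, [/\ clopen U, U !=set0 & forall x, U x -> ~ U (f x)].
Proof.
move=> f1; have [x fx] : exists x, f x <> x.
  apply: contrapT => /forallNP nf; apply: f1; apply: homeo_ext => x.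
  by apply: contrapT; exact: nf.
have /zdX [U [cU Ux nUfx]] : x != f x by apply/eqP=> /esym.
exists (U `\` f @^-1` U); split.
- rewrite setDE; apply: clopenI=> //; apply: (clopenC set0).
  exact: preimage_homeo_clopen.
- by exists x.
- by move=> y [Uy nUfy] [].
Qed.

(** Any nontrivial element is the product of two elements, each of which fixes
    some nonempty clopen set pointwise. *)
Lemma full_factor f : F f -> f <> 1 ->
  exists f1 f2 A1 A2, [/\ f = f1 * f2, clopen A1 /\ ~` A1 !=set0,
    clopen A2 /\ ~` A2 !=set0, rigid F A1 f1 & rigid F A2 f2].
Proof.
move=> Ff /displaced_clopen [U [cU [u Uu] fU]].
have [C [cC [c Cc] CU _ [v [Uv nCv]]]] := clopen_split u cU (ex_intro _ u Uu).
pose B := homeo_inv f @^-1` C.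
have cB : clopen B by exact: (@preimage_homeo_clopen _ f^-1).
have CB x : C x -> ~ B x.
  move=> Cx /CU Ufx; apply: (fU _ Ufx); rewrite homeoVK; exact: CU.
have [] := @full_exchange X F C B f (homeo_inv f) sF fullF cC cB CB.
- by move=> x Cx; rewrite /B /= homeoK.
- by [].
- by move=> x _; exact: homeoK.
- by move=> x _; exact: homeoVK.
- by move=> x _; exists setT, f; split=> //; exact: openT.
(* [s] agrees with [f] on [C] and exchanges [C] with its image [B], so [f * s]
   fixes [C] pointwise. *)
move=> s [Fs sCB sC sB]; exists (f * s), s^-1, (~` C), (C `|` B); split.
- by rewrite mulgK.
- by split; [exact: (clopenC set0)|exists c; rewrite setCK].
- split; first exact: clopenU.
  exists v => -[//|Bv]; apply: (fU (homeo_inv f v)); first exact: CU.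
  by rewrite homeoVK.
- split; first exact: subgroupM.
  move=> x /= /contrapT Cx; rewrite sB; last by rewrite /B /= homeoK.
  exact: homeoK.
- by split; [exact: subgroupV|exact: supportedV].
Qed.

(** A proper clopen set [W] can be moved into any nonempty clopen set [Z] in two
    steps, each supported in a proper clopen set. *)
Lemma move_into W Z :
    clopen W -> ~` W !=set0 -> clopen Z -> Z !=set0 ->
  exists A1 A2 Y g1 g2,
    [/\ clopen A1 /\ ~` A1 !=set0, clopen A2 /\ ~` A2 !=set0,
        rigid F A1 g1, rigid F A2 g2 &
        [/\ W `<=` A1, Y `<=` A2, forall x, W x -> Y (g1 x)
          & forall x, Y x -> Z (g2 x)]].
Proof.
move=> cW W' cZ [z Zz].
have [Y [cY Y0 YW nYz [a [nWa nYa]]]] := clopen_split z (clopenC set0 cW) W'.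
have cZY : clopen (Z `\` Y).
  by rewrite setDE; apply: clopenI => //; exact: (clopenC set0).
have ZY0 : Z `\` Y !=set0 by exists z.
have [V [cV V0 VZ _ [b [[Zb nYb] nVb]]]] := clopen_split z cZY ZY0.
have [g1 [Fg1 g1s g1W]] := cF cW cY (fun x Wx Yx => YW _ Yx Wx) Y0.
have [g2 [Fg2 g2s g2Y]] := cF cY cV (fun x Yx Vx => (VZ _ Vx).2 Yx) V0.
exists (W `|` Y), (Y `|` V), Y, g1, g2; split=> //; split.
- exact: clopenU.
- by exists a => -[].
- exact: clopenU.
- by exists b => -[].
- exact: subsetUl.
- exact: subsetUl.
- exact: g1W.
- by move=> x /g2Y /VZ [].
Qed.

Lemma local_commutator W f g :
  clopen W -> ~` W !=set0 -> rigid F W f -> rigid F W g -> M [~ f, g].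
Proof. by move=> cW W' Wf Wg; apply: sub_generated; exists W, f, g. Qed.

Let sM : is_subgroup M. Proof. exact: generated_subgroup. Qed.

Lemma local_commutatorsJ x g : M x -> F g -> M (x ^ g).
Proof.
move=> Mx Fg; apply: generated_conj Mx => _ [W [f [h [cW [w W'] Wf Wh ->]]]].
exists (homeo_inv g @^-1` W), (f ^ g), (h ^ g); split.
- exact: (@preimage_homeo_clopen _ g^-1).
- by exists (g w); rewrite /= homeoK.
- by apply: rigidJ Wf => // y Wy; rewrite /= homeoK.
- by apply: rigidJ Wh => // y Wy; rewrite /= homeoK.
- by rewrite conjRg.
Qed.

(** Modulo local commutators, the support of an element can be made arbitrarily
    small: conjugation by an element with a common proper clopen support changes
    it by a local commutator. *)
Lemma rigid_mod W Z f :
    clopen W -> ~` W !=set0 -> clopen Z -> Z !=set0 -> rigid F W f ->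
  exists m k, [/\ M m, rigid F Z k & f = m * k].
Proof.
move=> cW W' cZ Z0 Wf.
have [A1 [A2 [Y [g1 [g2 [[cA1 A1'] [cA2 A2'] Ag1 Ag2]]]]]] :=
  move_into cW W' cZ Z0.
move=> [WA YA g1W g2Y].
have Yf : rigid F Y (f ^ g1) by apply: rigidJ Wf => //; case: Ag1.
exists ([~ f^-1, g1] * [~ (f ^ g1)^-1, g2]), ((f ^ g1) ^ g2); split.
- apply: (subgroupM sM).
    apply: (local_commutator cA1) => //.
    apply: subgroupV; first exact: rigid_subgroup.
    exact: rigidS Wf.
  apply: (local_commutator cA2) => //.
  apply: subgroupV; first exact: rigid_subgroup.
  exact: rigidS Yf.
- by apply: rigidJ Yf => //; case: Ag2.
- by rewrite -mulgA -!conjg_split.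
Qed.

Lemma full_mod Z f : clopen Z -> Z !=set0 -> F f ->
  exists m k, [/\ M m, rigid F Z k & f = m * k].
Proof.
move=> cZ Z0 Ff; have [->|f1] := EM (f = 1).
  exists 1, 1; split; [exact: subgroup1| |by rewrite mulg1].
  by apply: subgroup1; exact: rigid_subgroup.
have [f1' [f2 [A1 [A2 [-> [cA1 A1'] [cA2 A2'] r1 r2]]]]] := full_factor Ff f1.
have [m1 [k1 [Mm1 Zk1 ->]]] := rigid_mod cA1 A1' cZ Z0 r1.
have [m2 [k2 [Mm2 Zk2 ->]]] := rigid_mod cA2 A2' cZ Z0 r2.
exists (m1 * m2 ^ k1^-1), (k1 * k2); split.
- apply: (subgroupM sM) => //; apply: local_commutatorsJ => //.
  by apply: subgroupV => //; case: Zk1.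
- by apply: subgroupM => //; exact: rigid_subgroup.
- by rewrite conjgE !invgK !mulgA mulgVK.
Qed.

Variable x0 : X.

Lemma derived_local : derived F `<=` M.
Proof.
have [Z [cZ Z0 _ nZ _]] := clopen_split x0 clopenT (ex_intro _ x0 I).
have Z' : ~` Z !=set0 by exists x0.
apply: generated_sub => // _ [f Ff] [g Fg] <-.
have [m [k [Mm [Fk Zk] ->]]] := full_mod cZ Z0 Ff.
have [m' [k' [Mm' [Fk' Zk'] eg]]] := full_mod cZ Z0 Fg.
apply: (commg_mod sM (H := F)) => //.
  by move=> u v; exact: local_commutatorsJ.
rewrite -invg_commg; apply: (subgroupV sM); rewrite eg.
apply: (commg_mod sM (H := F)) => //.
  by move=> u v; exact: local_commutatorsJ.
exact: (local_commutator cZ).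
Qed.

Lemma local_derived : M `<=` derived F.
Proof.
apply: generated_sub; first exact: generated_subgroup.
by move=> _ [W [f [g [_ _ [Ff _] [Fg _] ->]]]]; exact: derivedR.
Qed.

(** The derived subgroup moves any proper clopen set into any nonempty clopen
    set: an element of [F] doing so is corrected, off the image, by an element
    in the same class modulo the derived subgroup. *)
Lemma derived_move W Z :
    clopen W -> ~` W !=set0 -> clopen Z -> Z !=set0 ->
  exists2 d, derived F d & forall x, W x -> Z (d x).
Proof.
move=> cW W' cZ Z0.
have [A1 [A2 [Y [g1 [g2 [_ _ [Fg1 _] [Fg2 _]]]]]]] := move_into cW W' cZ Z0.
move=> [_ _ g1W g2Y].
have [g [Fg gW]] : exists g, F g /\ forall x, W x -> Z (g x).
  exists (g1 * g2); split; first exact: subgroupM.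
  by move=> x /g1W /g2Y.
have cV : clopen (homeo_inv g @^-1` (~` W)).
  by apply: (@preimage_homeo_clopen _ g^-1); exact: (clopenC set0).
have V0 : homeo_inv g @^-1` (~` W) !=set0.
  by case: W' => w nWw; exists (g w); rewrite /preimage /= homeoK.
have [m [k [Mm [_ kV] gE]]] := full_mod cV V0 Fg.
exists m; first exact: local_derived.
move=> x Wx; have -> : m = g * k^-1 by rewrite gE mulgK.
rewrite homeoM (supportedV kV); first exact: gW.
by rewrite /preimage /= homeoK; apply.
Qed.

(** The double commutator argument: if [g] moves [V] off itself, then
    [[g, a], b] = [a, b] for [a] and [b] supported in [V]. For [f] and [h]
    supported in a suitable [U] inside [V], there are such [a] and [b] in the
    derived subgroup with [a, b] = [f^-1, h^-1]. *)
Lemma normal_rigid_commutators N g :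
    normal_in N (derived F) -> N g -> g <> 1 ->
  exists U, [/\ clopen U, U !=set0
    & forall f h, rigid F U f -> rigid F U h -> N [~ f, h]].
Proof.
move=> [sN ND NJ] Ng /displaced_clopen [V [cV [v Vv] gV]].
have NR u d : N u -> derived F d -> N [~ u, d].
  move=> Nu Dd; rewrite commgEl.
  by apply: subgroupM => //; [exact: subgroupV|exact: NJ].
have [U [cU U0 UV _ [z VUz]]] := clopen_split v cV (ex_intro _ v Vv).
have cVU : clopen (V `\` U).
  by rewrite setDE; apply: clopenI => //; exact: (clopenC set0).
have [U1 [cU1 U10 U1V _ U20]] := clopen_split z cVU (ex_intro _ z VUz).
pose U2 := (V `\` U) `\` U1.
have cU2 : clopen U2.
  by rewrite /U2 setDE; apply: clopenI => //; exact: (clopenC set0).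
have UU1 x : U x -> ~ U1 x by move=> Ux /U1V [].
have UU2 x : U x -> ~ U2 x by move=> Ux [[]].
have U12 x : U1 x -> ~ U2 x by move=> U1x [].
have U1V' : U1 `<=` V by move=> x /U1V [].
have U2V : U2 `<=` V by move=> x [[]].
(* Conjugation by [s] and by [t] puts copies of [f] and [h] in the disjoint sets
   [U1] and [U2]; the copies then do not contribute to [[a, b]]. *)
have [s [Fs _ sU]] := cF cU cU1 UU1 U10.
have [t [Ft _ tU]] := cF cU cU2 UU2 U20.
exists U; split=> //.
suff key f h : rigid F U f -> rigid F U h -> N [~ f^-1, h^-1].
  move=> f h Uf Uh; rewrite -[f]invgK -[h]invgK.
  by apply: key; apply: subgroupV => //; exact: rigid_subgroup.
move=> [Ff fU] [Fh hU].
have fs1 : supported U1 (f ^ s) by exact: supportedJ fU.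
have ht2 : supported U2 (h ^ t) by exact: supportedJ hU.
pose a := [~ f, s]; pose b := [~ h, t].
have Da : derived F a by exact: derivedR.
have Db : derived F b by exact: derivedR.
have fVU := supportedV fU; have hVU := supportedV hU.
have aV : supported V a.
  rewrite /a commgEl; apply: supportedM; first exact: supportedS fVU.
  exact: supportedS fs1.
have bV : supported V b.
  rewrite /b commgEl; apply: supportedM; first exact: supportedS hVU.
  exact: supportedS ht2.
have gab : N [~ [~ g, a], b] by apply: (NR) => //; exact: NR.
suff <- : [~ [~ g, a], b] = [~ f^-1, h^-1] by [].
have -> : [~ g, a] = (a ^ g)^-1 * a.
  by rewrite commgEr -conjVg; congr (_ * _); rewrite conjVg.
rewrite commg_dropl.
  rewrite /a /b (commgEl f) (commgEl h).
  have c1 : commute (f ^ s) h^-1.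
    by apply: commute_supported fs1 hVU => x U1x /UU1.
  have c2 : commute (f ^ s) (h ^ t) by apply: commute_supported fs1 ht2.
  have c3 : commute f^-1 (f ^ s) by apply: commute_supported fVU fs1.
  have c4 : commute f^-1 (h ^ t) by apply: commute_supported fVU ht2.
  have c5 : commute h^-1 (h ^ t) by apply: commute_supported hVU ht2.
  rewrite c3 commg_dropl; last exact: commuteM.
  by rewrite c5 commg_dropr//; exact: commute_sym.
have : supported (homeo_inv g @^-1` V) (a ^ g)^-1.
  apply: supportedV; apply: supportedJ aV => x Vx.
  by rewrite /preimage /= homeoK.
move=> agV; apply: commute_supported agV bV => x /= gx Vx.
by apply: (gV _ gx); rewrite homeoVK.
Qed.

(** For disjoint nonempty clopen sets [A], [B] and [C], an element moving [A]
    into [B] and fixing [C] does not commute with one moving [A] into [C] and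
    fixing [B]. *)
Lemma derived_nontrivial : derived F <> [set 1].
Proof.
have [A [cA [a Aa] _ _ [z [_ nAz]]]] :=
  clopen_split x0 clopenT (ex_intro _ x0 I).
have [B [cB B0 BA _ C0]] := clopen_split z (clopenC set0 cA) (ex_intro _ z nAz).
pose C := ~` A `\` B.
have cC : clopen C.
  by rewrite /C setDE; apply: clopenI; exact: (clopenC set0).
have [s [Fs sAB sA]] := cF cA cB (fun x Ax Bx => BA _ Bx Ax) B0.
have [t [Ft tAC tA]] := cF cA cC (fun x Ax (Cx : C x) => Cx.1 Ax) C0.
move=> D1; have : derived F [~ s, t] by exact: derivedR.
rewrite D1 => /= /eqP /commgP /(congr1 (fun u : homeo X => u a)).
rewrite !homeoM => st.
have Bsa := sA _ Aa; have [nAta nBta] := tA _ Aa.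
rewrite (tAC (s a)) in st; last by move=> [/(BA _ Bsa)|[_]].
rewrite (sAB (t a)) in st; last by case.
by rewrite st in Bsa.
Qed.

Theorem full_derived_simple : simple_subgroup (derived F).
Proof.
split; [exact: generated_subgroup|exact: derived_nontrivial|].
move=> N nN; have [sN ND NJ] := nN.
have [N1|/existsNP [g /not_implyP [Ng g1]]] := EM (forall g, N g -> g = 1).
  left; apply/seteqP; split=> [g /N1 //|_ ->]; exact: subgroup1.
right; apply/seteqP; split=> // d /derived_local; apply: generated_sub => //.
have [U [cU U0 UN]] := normal_rigid_commutators nN Ng g1.
move=> _ [W [f [h [cW W' Wf Wh ->]]]].
have [e De We] := derived_move cW W' cU U0.
have Fe : F e by exact: derived_sub De.
rewrite -(conjgK e [~ f, h]); apply: NJ.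
  by rewrite conjRg; apply: UN; apply: rigidJ => //; eassumption.
exact: (subgroupV (generated_subgroup _) De).
Qed.

End DerivedSimple.

(** * The topology of Cantor space *)

Section CantorTopology.
Local Open Scope classical_set_scope.
Local Open Scope group_scope.
Variable n : nat.
Implicit Types (d : cantor n) (w u v : seq 'I_n) (A : set (cantor n)).
Local Open Scope nat_scope.

(** The infinite words [d] and [d'] have the same first [m] letters. *)
Definition agree m d d' := forall i, i < m -> d' i = d i.

Let cylinder_filter d : set_system (cantor n) :=
  [set A | exists m, agree m d `<=` A].

Let cylinder_filter_filter d : Filter (cylinder_filter d).
Proof.
split.
- by exists 0.
- move=> A B [m mA] [k kB]; exists (maxn m k) => d' dd'.
  by split; [apply: mA|apply: kB] => i im; apply: dd'; rewrite leq_max im ?orbT.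
- by move=> A B AB [m mA]; exists m; exact: subset_trans AB.
Qed.

(** The sets containing all words that agree with [d] far enough are the
    neighbourhoods of [d] in the product topology. *)
Lemma cantor_nbhsP d A : nbhs d A <-> exists m, agree m d `<=` A.
Proof.
split.
  have FF := cylinder_filter_filter d; suff : cylinder_filter d --> d by apply.
  apply/cvg_sup => i U [V [[W _ <-] /= Wd VU]].
  exists i.+1 => d' dd'; apply: VU => /=; rewrite /proj dd'//.
move=> [m mA]; apply: filterS mA _.
elim: m => [|m IHm]; first by apply: filterS filterT.
have nm : nbhs d [set d' : cantor n | d' m = d m].
  exact: (@proj_continuous _ (fun _ : nat => discrete_topology 'I_n) m d _
    (discrete_set1 (d m : discrete_topology 'I_n))).
apply: filterS (filterI IHm nm) => d' [dd' ddm] i.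
by rewrite ltnS leq_eqVlt => /orP[/eqP ->|/dd'].
Qed.

Lemma cantor_openP A :
  open A <-> forall d, A d -> exists m, agree m d `<=` A.
Proof.
rewrite openE; split=> Ao d Ad; first exact/cantor_nbhsP/Ao.
exact/cantor_nbhsP/Ao.
Qed.

Lemma cantor_continuous (f : cantor n -> cantor n) :
    (forall d j, exists m, forall d', agree m d d' -> f d' j = f d j) ->
  continuous f.
Proof.
move=> fc d A /cantor_nbhsP [k kA]; apply/cantor_nbhsP.
suff [m mf] : exists m, forall d', agree m d d' -> agree k (f d) (f d').
  by exists m => d' /mf /kA.
elim: k {A kA} => [|k [m IHk]]; first by exists 0.
have [m' fk] := fc d k; exists (maxn m m') => d' dd' i.
rewrite ltnS leq_eqVlt => /orP[/eqP ->|].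
  by apply: fk => j jm; apply: dd'; rewrite leq_max jm orbT.
by apply: IHk => j jm; apply: dd'; rewrite leq_max jm.
Qed.

(** A set whose membership is decided by the first [m] letters is clopen. *)
Lemma cantor_clopen m A :
  (forall d d', agree m d d' -> A d -> A d') -> clopen A.
Proof.
move=> mA; split.
  by apply/cantor_openP => d Ad; exists m => d' /mA; apply.
rewrite -openC; apply/cantor_openP => d nAd; exists m => d' dd' Ad'; apply: nAd.
by apply: (mA d') => // i im; rewrite dd'.
Qed.

Lemma cantor_zero_dimensional : zero_dimensional (cantor n).
Proof.
move=> d d' dd'; have [i di] : exists i, d i <> d' i.
  apply: contrapT => /forallNP dd; case/eqP: dd'; apply/funext => i.
  exact: contrapT (dd i).
exists [set c | c i = d i]; split=> //; last by move=> /= e; apply: di.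
by apply: (@cantor_clopen i.+1) => c c' cc' /= <-; exact: cc'.
Qed.

Lemma cantor_perfect : 1 < n -> perfect_set [set: cantor n].
Proof.
move=> n1; apply/perfectTP => d /cantor_openP /(_ d erefl) [m md].
have [x xd] : exists x : 'I_n, x != d m.
  have n0 : 0 < n by exact: ltnW.
  case: (eqVneq (Ordinal n0) (d m)) => [<-|]; last by exists (Ordinal n0).
  by exists (Ordinal n1).
have : [set d] (fun i => if i == m then x else d i : 'I_n).
  by apply: md => i; case: eqVneq => // ->; rewrite ltnn.
move=> /= /(congr1 (fun c => c m)) /eqP; rewrite eqxx => /eqP xE.
by rewrite xE eqxx in xd.
Qed.

(** * Infinite words and their prefixes *)

(** [shift k d] is [d] without its first [k] letters. *)
Definition shift k d : cantor n := fun i => d (k + i).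

(** The finite word [w] is a prefix of the infinite word [d]. *)
Definition starts w d : bool := wprefix d (size w) == w.

Lemma shift0 d : shift 0 d = d. Proof. by []. Qed.

Lemma shiftD j k d : shift k (shift j d) = shift (j + k) d.
Proof. by apply/funext => i; rewrite /shift addnA. Qed.

Lemma wcat_nil d : wcat [::] d = d.
Proof. by apply/funext => i; rewrite /wcat nth_nil subn0. Qed.

Lemma wcat_cat u v d : wcat (u ++ v) d = wcat u (wcat v d).
Proof.
apply/funext => i; rewrite /wcat nth_cat size_cat subnDA.
by case: ltnP => iu; [exact: set_nth_default|rewrite (nth_default _ iu)].
Qed.

Lemma wcat_ge w d i : wcat w d (size w + i) = d i.
Proof. by rewrite /wcat nth_default ?leq_addr// addKn. Qed.

Lemma shift_wcat w d : shift (size w) (wcat w d) = d.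
Proof. by apply/funext => i; exact: wcat_ge. Qed.


Lemma starts_wcat w d : starts w (wcat w d).
Proof.
apply/eqP/(@eq_from_nth _ (d 0)) => [|i]; rewrite size_mkseq// => iw.
by rewrite /wprefix nth_mkseq// /wcat; exact: set_nth_default.
Qed.

Lemma startsP w d : reflect (wcat w (shift (size w) d) = d) (starts w d).
Proof.
apply: (iffP idP) => [/eqP dw|<-]; last exact: starts_wcat.
apply/funext => i; rewrite /wcat /shift.
have [wi|iw] := leqP (size w) i; first by rewrite nth_default// subnKC.
rewrite -[RHS](nth_mkseq (d (size w + (i - size w))) d iw).
by rewrite -/(wprefix _ _) dw.
Qed.

Lemma startsE w d : starts w d = `[< cone w d >].
Proof.
apply/idP/asboolP => [/startsP <-|[c _ <-]]; last exact: starts_wcat.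
by exists (shift (size w) d).
Qed.

Lemma starts_cons x w d :
  starts (x :: w) d = (d 0 == x) && starts w (shift 1 d).
Proof.
rewrite /starts /wprefix /mkseq /= eqseq_cons; congr (_ && _); congr (_ == _).
by rewrite -[1]/(1 + 0) iotaDl -map_comp; apply: eq_map.
Qed.

Lemma starts_cat u v d :
  starts (u ++ v) d = starts u d && starts v (shift (size u) d).
Proof.
elim: u d => [|x u IHu] d /=; first by rewrite shift0.
by rewrite !starts_cons IHu shiftD andbA.
Qed.

Lemma starts_agree w d d' : agree (size w) d d' -> starts w d' = starts w d.
Proof.
move=> dd'; rewrite /starts; congr (_ == _); apply/eq_in_map => i.
by rewrite mem_iota => /dd'.
Qed.

Lemma starts_wprefixP d m d' : reflect (agree m d d') (starts (wprefix d m) d').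
Proof.
rewrite /starts size_mkseq; apply: (iffP eqP) => [e i im|dd'].
  by rewrite -(nth_mkseq (d 0) d' im) -[mkseq d' m]/(wprefix d' m) e nth_mkseq.
by apply/eq_in_map => i; rewrite mem_iota => /dd'.
Qed.

Lemma shift_continuous k : continuous (shift k).
Proof.
apply: cantor_continuous => d j; exists (k + j).+1 => d' dd'.
exact: dd'.
Qed.

(** * Complete prefix codes and prefix replacement *)

(** The finite sequence [e] enumerates a maximal antichain: every infinite word
    has exactly one prefix in [e]. *)
Definition complete_code (e : seq (seq 'I_n)) :=
  forall d, count (starts^~ d) e = 1.

Lemma find_count1 (S : Type) (s0 : S) (a : pred S) (s : seq S) i :
  count a s = 1 -> i < size s -> a (nth s0 s i) -> find a s = i.
Proof.
elim: s i => // x s IHs [|i] /=; first by move=> _ _ ->.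
rewrite ltnS; case: (a x) => [[c0] il ai|c1 il ai]; last by rewrite (IHs i).
have : has a s by apply/(has_nthP s0); exists i.
by rewrite has_count -[count a s]add0n c0.
Qed.

Lemma complete_code_has e d : complete_code e -> has (starts^~ d) e.
Proof. by move=> /(_ d) ce; rewrite has_count ce. Qed.

Lemma complete_code_find e d i : complete_code e -> i < size e ->
  starts (nth [::] e i) d -> find (starts^~ d) e = i.
Proof.
by move=> /(_ d) ce il st; exact: (@find_count1 _ [::] _ _ _ ce il st).
Qed.

Lemma complete_code_maximal e l : complete_code e -> size e = l ->
  maximal_antichain (fun i : 'I_l => nth [::] e i).
Proof.
move=> ce se; subst l; split.
  apply/seteqP; split=> // d _.
  have hd := complete_code_has d ce; have hl := hd; rewrite has_find in hl.
  exists (Ordinal hl) => //=; apply/asboolP; rewrite -startsE.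
  exact: (@nth_find _ [::] (starts^~ d)).
move=> i j _ _ [d [/= /asboolP di /asboolP dj]]; apply/val_inj.
rewrite -startsE in di; rewrite -startsE in dj.
by rewrite /= -(complete_code_find ce _ di)// -(complete_code_find ce _ dj).
Qed.

Lemma maximal_complete_code l (eta : 'I_l -> seq 'I_n) :
  maximal_antichain eta -> complete_code (map eta (enum 'I_l)).
Proof.
move=> [cov triv] d; have : setT d by []; rewrite -cov => -[i _ di].
rewrite count_map -(@eq_count _ (pred1 i)) => [|j /=].
  by rewrite count_uniq_mem ?enum_uniq// mem_enum.
rewrite startsE; apply/eqP/asboolP => [->//|dj].
by apply: triv => //; exists d.
Qed.

(** The words that leave [p] at their last letter: those [u y] such that [u x]
    is a prefix of [p] for some letter [x] other than [y]. *)
Fixpoint branches (p : seq 'I_n) : seq (seq 'I_n) :=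
  if p is x :: p' then
    [seq [:: y] | y <- rem x (enum 'I_n)] ++ map (cons x) (branches p')
  else [::].

Lemma size_branches p : size (branches p) = size p * n.-1.
Proof.
elim: p => //= x p IHp; rewrite size_cat !size_map IHp size_rem ?mem_enum//.
by rewrite size_enum_ord mulSn.
Qed.

Lemma count_letter (P : pred 'I_n) x :
  P =1 pred1 x -> count P (enum 'I_n) = 1.
Proof.
by move=> /eq_count ->; rewrite count_uniq_mem ?enum_uniq// mem_enum.
Qed.

Lemma starts1 x d : starts [:: x] d = (d 0 == x).
Proof. by rewrite starts_cons andbT. Qed.

Lemma complete_branches p : complete_code (p :: branches p).
Proof.
elim: p => [|x p IHp] d //=.
rewrite count_cat !count_map starts_cons.
have -> : count (preim (cons x) (starts^~ d)) (branches p)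
        = (d 0 == x) * count (starts^~ (shift 1 d)) (branches p).
  case: eqP => dx; last rewrite mul0n.
    by rewrite mul1n; apply: eq_count => w; rewrite /= starts_cons dx eqxx.
  rewrite -(count_pred0 (branches p)); apply: eq_count => w /=.
  by rewrite starts_cons; case: eqP.
have := IHp (shift 1 d); rewrite /=.
have : count (preim (fun y => [:: y]) (starts^~ d)) (enum 'I_n) = 1.
  by apply: (@count_letter _ (d 0)) => y; rewrite /= starts1 eq_sym.
rewrite (permP (perm_to_rem (_ : x \in enum 'I_n))) ?mem_enum//= starts1.
case: (d 0 == x) => /=; last by rewrite mul0n addn0 !add0n.
by move=> [c0]; rewrite mul1n; move: c0; rewrite add0n => ->.
Qed.

Lemma count_children w d :
  count (starts^~ d) [seq rcons w x | x <- enum 'I_n] = starts w d.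
Proof.
rewrite count_map; case wd: (starts w d).
  apply: (@count_letter _ (d (size w))) => x.
  by rewrite /= -cats1 starts_cat wd starts1 /shift addn0 eq_sym.
rewrite (@eq_count _ _ pred0) ?count_pred0// => x /=.
by rewrite -cats1 starts_cat wd.
Qed.

(** The words that extend [w] by one letter. *)
Definition children w := [seq rcons w x | x <- enum 'I_n].

Lemma complete_code_expand r1 w r2 :
  complete_code (r1 ++ w :: r2) -> complete_code (r1 ++ children w ++ r2).
Proof. by move=> cr d; rewrite -(cr d) !count_cat /= count_children. Qed.

(** The code can be enlarged from the branches of [p] by repeatedly splitting a
    word other than [p]; each step adds [n - 1] words. *)
Lemma complete_code_with p k : 1 < n -> p != [::] -> size p <= k ->
  exists r, complete_code (p :: r) /\ size r = k * n.-1.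
Proof.
move=> n1 p0; elim: k => [|k IHk]; first by rewrite leqn0 size_eq0 (negbTE p0).
rewrite leq_eqVlt => /orP[/eqP pk|].
  exists (branches p); split; first exact: complete_branches.
  by rewrite size_branches pk.
move=> pk; have [[|w r] [cr sr]] := IHk pk.
  move: sr => /esym/eqP; rewrite muln_eq0; case: k pk {IHk} => [|k] /=.
    by rewrite ltnS leqn0 size_eq0 (negbTE p0).
  by move=> _; rewrite -subn1 subn_eq0 leqNgt n1.
exists (children w ++ r); split.
  exact: (@complete_code_expand [:: p]).
rewrite size_cat size_map size_enum_ord mulSn -sr /= addnS -addSn.
by rewrite prednK// ltnW.
Qed.
End CantorTopology.

Arguments starts {n} w d.

(** * Prefix replacement *)

Section PrefixReplacement.
Local Open Scope classical_set_scope.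
Local Open Scope group_scope.
Variable n : nat.
Implicit Types (d : cantor n) (e : seq (seq 'I_n)).
Local Open Scope nat_scope.

(** Replaces the prefix in [e] of an infinite word by the word of [e'] with the
    same index. *)
Definition replace e e' d : cantor n :=
  let i := find (starts^~ d) e in
  wcat (nth [::] e' i) (shift (size (nth [::] e i)) d).

Lemma replace_wcat e e' i d : complete_code e -> i < size e ->
  replace e e' (wcat (nth [::] e i) d) = wcat (nth [::] e' i) d.
Proof.
move=> ce ie; rewrite /replace (complete_code_find ce ie) ?starts_wcat//.
by rewrite shift_wcat.
Qed.

Lemma complete_code_nth e d : complete_code e ->
  exists2 i, i < size e & exists c, d = wcat (nth [::] e i) c.
Proof.
move=> ce; have hd := complete_code_has d ce.
exists (find (starts^~ d) e); first by rewrite -has_find.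
have /startsP de := @nth_find _ [::] (starts^~ d) e hd.
by exists (shift (size (nth [::] e (find (starts^~ d) e))) d).
Qed.

Lemma replaceK e e' : complete_code e -> complete_code e' -> size e = size e' ->
  cancel (replace e e') (replace e' e).
Proof.
move=> ce ce' se d; have [i ie [c ->]] := complete_code_nth d ce.
by rewrite !replace_wcat// -se.
Qed.

Lemma replace_continuous e e' : complete_code e -> continuous (replace e e').
Proof.
move=> ce; apply: cantor_continuous => d j.
have [i ie [c ->]] := complete_code_nth d ce; set w := nth [::] e i.
exists (size w + j).+1 => d' dd'.
have /startsP <- : starts w d'.
  rewrite (@starts_agree _ w (wcat w c)) ?starts_wcat// => k kw; apply: dd'.
  by rewrite ltnS (leq_trans (ltnW kw))// leq_addr.
rewrite !replace_wcat// /wcat; congr nth.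
rewrite /shift dd' ?wcat_ge// ltnS leq_add2l.
exact: leq_subr.
Qed.

Definition replace_homeo e e' (ce : complete_code e) (ce' : complete_code e')
    (se : size e = size e') : homeo (cantor n) :=
  Homeo (replaceK ce ce' se) (replaceK ce' ce (esym se))
    (@replace_continuous e e' ce) (@replace_continuous e' e ce').

End PrefixReplacement.

(** * Completions of a transducer *)

Section Completions.
Local Open Scope classical_set_scope.
Local Open Scope group_scope.
Variables (n : nat) (T : transducer n).
Implicit Types (d : cantor n) (q : state T) (u v w : seq 'I_n).
Local Open Scope nat_scope.

Let outw := word_out (@Defs.next n T) (@out n T).

Lemma word_out_cat u v q :
  outw (u ++ v) q = outw u q ++ outw v (word_next (@Defs.next n T) u q).
Proof.
by elim: u q => //= x u IHu q; rewrite /outw /= -catA; congr cat; exact: IHu.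
Qed.

Lemma wprefixD d k m : wprefix d (k + m) = wprefix d k ++ wprefix (shift k d) m.
Proof.
rewrite /wprefix /mkseq iotaD map_cat; congr cat.
by rewrite add0n -[X in iota X m]addn0 iotaDl -map_comp.
Qed.

(** Any prefix with enough output computes a given letter of [T_q(d)]. *)
Lemma state_mapE q d i m a : i < size (outw (wprefix d m) q) ->
  state_map q d i = nth a (outw (wprefix d m) q) i.
Proof.
move=> im; rewrite /state_map; case: ex_minnP => k ik /(_ _ im) km.
rewrite -(subnKC km) wprefixD [outw (_ ++ _) _]word_out_cat nth_cat.
by rewrite [X in _ < X]/= ik; apply: set_nth_default.
Qed.

Lemma state_map_cons q x d :
  state_map q (wcat [:: x] d) = wcat (out x q) (state_map (Defs.next x q) d).
Proof.
apply/funext => i; set w := out x q.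
have [m im] := out_infinite (Defs.next x q) d (i - size w).
have wE : outw (wprefix (wcat [:: x] d) m.+1) q
    = w ++ outw (wprefix d m) (Defs.next x q).
  rewrite -[m.+1]/(1 + m) wprefixD word_out_cat.
  by rewrite (shift_wcat [:: x]) /= /outw /= cats0.
pose a := state_map (Defs.next x q) d (i - size w).
rewrite (@state_mapE _ _ _ m.+1 a) wE.
  rewrite nth_cat /wcat; case: ltnP => [//|wi]; rewrite [RHS]nth_default//.
  by rewrite (state_mapE a im).
rewrite size_cat; have [wi|iw] := leqP (size w) i; first by rewrite -ltn_subLR.
exact: ltn_addr.
Qed.

(** A presentation of [h] as a completion: for each triple [(eta, rho, q)] of
    [t], the map [h] sends [eta d] to [rho T_q(d)]. The sets [rho im(q)] are
    then the images of the cones of a maximal antichain, so viability is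
    automatic. *)
Definition presents (h : homeo (cantor n))
    (t : seq (seq 'I_n * seq 'I_n * state T)) :=
  complete_code [seq c.1.1 | c <- t] /\
  forall c, c \in t -> forall d,
    h (wcat c.1.1 d) = wcat c.1.2 (state_map c.2 d).

Lemma completion_presents (h : homeo (cantor n)) : completion T h ->
  exists t, presents h t /\ size t = 1 %[mod n.-1].
Proof.
move=> [l [rho [p [eta [_ lE maxe he]]]]].
exists [seq (eta i, rho i, p i) | i <- enum 'I_l]; split; last first.
  by rewrite size_map size_enum_ord.
split; first by rewrite -map_comp; exact: maximal_complete_code.
by move=> c /mapP[i _ ->] d; exact: he.
Qed.

(** Splitting the cone of a triple into its [n] children: since
    [T_q(x d) = out(x, q) T_q'(d)], where [q'] is the state after [x], the
    length of a presentation can be increased by [n - 1]. *)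
Lemma presents_expand h t : 0 < n -> presents h t -> t != [::] ->
  exists t', [/\ presents h t', t' != [::] & size t' = size t + n.-1].
Proof.
move=> n0; case: t => // -[[eta rho] q] t [ct ht] _.
pose split_eta :=
  [seq (rcons eta x, rho ++ out x q, Defs.next x q) | x <- enum 'I_n].
exists (split_eta ++ t).
have st : size (split_eta ++ t) = (size t).+1 + n.-1.
  by rewrite size_cat size_map size_enum_ord addSnnS prednK// addnC.
split=> //; last by rewrite -size_eq0 st addSn.
split.
  by rewrite map_cat -map_comp; exact: (@complete_code_expand _ [::]).
move=> c; rewrite mem_cat => /orP[/mapP[x _ ->] d|ctl]; last first.
  by apply: ht; rewrite inE ctl orbT.
rewrite -cats1 !wcat_cat (ht (eta, rho, q)) ?mem_head//=.
by rewrite state_map_cons.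
Qed.

(** The same pieces can be laid out along any complete code of the same length:
    precomposing [h] with a prefix replacement gives a completion. *)
Lemma presentation_completion h t e :
    presents h t -> size t = 1 %[mod n.-1] ->
    complete_code e -> size e = size t ->
  exists g : homeo (cantor n), completion T g /\
    forall i d, i < size e ->
      g (wcat (nth [::] e i) d) = h (wcat (nth [::] [seq c.1.1 | c <- t] i) d).
Proof.
move=> [ct ht] t1 ce se; pose e0 := [seq c.1.1 | c <- t].
have se0 : size e = size e0 by rewrite size_map.
pose tr i := tnth (in_tuple t) i.
have e0E (i : 'I_(size t)) : nth [::] e0 i = (tr i).1.1.
  have tE : tr i = nth (tr i) t i by exact: tnth_nth.
  by rewrite (nth_map (tr i)) ?ltn_ord// -tE.
have hE i d : h (wcat (tr i).1.1 d) = wcat (tr i).1.2 (state_map (tr i).2 d).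
  by apply: ht; exact: mem_tnth.
pose g : homeo (cantor n) := (replace_homeo ce ct se0 * h)%g.
have gE i d : i < size e ->
    g (wcat (nth [::] e i) d) = h (wcat (nth [::] e0 i) d).
  by move=> ie; rewrite homeoM /= replace_wcat.
exists g; split=> //.
exists (size t), (fun i => (tr i).1.2), (fun i => (tr i).2),
  (fun i : 'I_(size t) => nth [::] e i); split=> //.
- split.
    apply/seteqP; split=> // y _.
    have [i it [c hc]] := complete_code_nth (homeo_inv h y) ct.
    rewrite size_map in it; exists (Ordinal it) => //.
    exists (state_map (tr (Ordinal it)).2 c); first by exists c.
    by rewrite -hE -e0E -hc homeoVK.
  move=> i j _ _ [_ [[_ [c _ <-] <-] [_ [c' _ <-]]]].
  rewrite -!hE -!e0E => /homeo_inj cc'; apply/val_inj.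
  have e0i : i < size e0 by rewrite size_map.
  have e0j : j < size e0 by rewrite size_map.
  rewrite /= -(complete_code_find ct e0i (starts_wcat _ c)) -cc'.
  exact: (complete_code_find ct e0j (starts_wcat _ c')).
- exact: complete_code_maximal.
- by move=> i d; rewrite gE ?se// e0E hE.
Qed.

Lemma completion_nonempty h t : 0 < n -> presents h t -> t != [::].
Proof.
move=> n0 [ct _]; case: t ct => // /(_ (fun=> Ordinal n0)).
by [].
Qed.

Lemma presents_long h : 0 < n -> completion T h ->
  exists k0, forall k, k0 <= k -> exists t, presents h t /\ size t = (k * n.-1).+1.
Proof.
move=> n0 /completion_presents [t [ht t1]].
have t0 := completion_nonempty n0 ht.
have [k0 st] : exists k0, size t = (k0 * n.-1).+1.
  have st : 0 < size t by rewrite lt0n size_eq0.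
  move: t1; rewrite -(prednK st) -addn1 -[X in _ = X %[mod _]]add0n => /eqP.
  rewrite eqn_modDr mod0n => /dvdnP [k kE]; exists k.
  by rewrite -kE addn1.
exists k0; elim=> [|k IHk].
  by rewrite leqn0 => /eqP k00; exists t; rewrite st k00.
rewrite leq_eqVlt => /orP[/eqP <-|]; first by exists t.
move=> /IHk [t' [ht' st']].
have [t2 [ht2 _ st2]] := presents_expand n0 ht' (completion_nonempty n0 ht').
by exists t2; split=> //; rewrite st2 st' mulSn addSn addnC.
Qed.

Lemma completion_subgroup : is_subgroup (completion_group T).
Proof. exact: generated_subgroup. Qed.

Lemma full_group_subgroup : is_subgroup (full_group T).
Proof. exact: locally_agrees_subgroup completion_subgroup. Qed.

Lemma full_full_group : full (full_group T).
Proof. exact: locally_agrees_full completion_subgroup. Qed.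

Lemma completion_full_group g : completion_group T g -> full_group T g.
Proof. by move=> Tg x; exists setT, g; split=> //; exact: openT. Qed.

(** Prepending a letter locally agrees with the group: two completions with the
    same pieces, laid out along complete codes that have [y] and [ay] at the
    same position, differ by an element of the group that maps [y d] to [ay d]. *)
Lemma prepend_letter_agrees (hn : 1 < n) h a x :
  completion T h -> agrees_at (full_group T) (wcat [:: a]) x.
Proof.
move=> Th; have n0 := ltnW hn; have [k0 long] := presents_long n0 Th.
(* A code of [k (n - 1) + 1] words can contain the two-letter word [ay] only if
   [k >= 2]. *)
pose k := maxn k0 2.
have [t [ht st]] := long k (leq_maxl _ _).
have t1 : size t = 1 %[mod n.-1] by rewrite st -addn1 modnMDl.
have [r1 [c1 s1]] :=
  @complete_code_with n [:: x 0] k hn isT (ltnW (leq_maxr _ _)).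
have [r2 [c2 s2]] := @complete_code_with n [:: a; x 0] k hn isT (leq_maxr _ _).
have [] := presentation_completion ht t1 c1; first by rewrite /= s1 st.
move=> g1 [Tg1 g1E].
have [] := presentation_completion ht t1 c2; first by rewrite /= s2 st.
move=> g2 [Tg2 g2E].
exists [set d | starts [:: x 0] d], (g1 * g2^-1)%g; split.
- apply: (@cantor_clopen n 1 _ _).1 => d d' dd' /=.
  by rewrite (@starts_agree _ _ d d').
- by rewrite /= starts1.
- apply: completion_full_group; apply: (subgroupM completion_subgroup).
    exact: sub_generated.
  by apply: (subgroupV completion_subgroup); exact: sub_generated.
move=> d; rewrite inE /= => /startsP <-; rewrite -wcat_cat /=.
have e1 := g1E 0 (shift 1 d) isT; have e2 := g2E 0 (shift 1 d) isT.
apply: (@homeo_inj _ g2); rewrite [RHS]homeoVK /=.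
by rewrite /= in e1 e2; rewrite e1 e2.
Qed.

Lemma prepend_agrees (hn : 1 < n) h w x :
  completion T h -> agrees_at (full_group T) (wcat w) x.
Proof.
move=> Th; elim: w => [|a w IHw].
  exists setT, 1%g; split=> //; first exact: openT.
    exact: subgroup1 full_group_subgroup.
  by move=> d _; rewrite wcat_nil.
have -> : wcat (a :: w) = wcat [:: a] \o wcat w.
  by apply/funext => d; rewrite -[a :: w]cat1s wcat_cat.
apply: (agrees_at_comp full_group_subgroup IHw).
exact: prepend_letter_agrees Th.
Qed.

(** A clopen set [A] is moved into a cone [w] contained in [B] by exchanging [A]
    with [wA]. *)
Lemma full_group_compressible (hn : 1 < n) h :
  completion T h -> compressible (full_group T).
Proof.
move=> Th A B cA cB AB [b Bb].
have [m mB] : exists m, agree m b `<=` B by case: cB => /cantor_openP /(_ b Bb).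
pose w := wprefix b m.
have wB d : starts w d -> B d by move/starts_wprefixP; exact: mB.
pose C := [set d | starts w d /\ A (shift (size w) d)].
have CB : C `<=` B by move=> d [/wB].
have cC : clopen C.
  apply: clopenI; last exact: (preimage_clopen cA (@shift_continuous n _)).
  apply: (@cantor_clopen n (size w)) => d d' dd' /=.
  by rewrite (starts_agree dd').
have [] := @full_exchange _ (full_group T) A C (wcat w) (shift (size w))
  full_group_subgroup full_full_group cA cC.
- by move=> d Ad /CB; exact: AB.
- by move=> d Ad; split; rewrite ?starts_wcat ?shift_wcat.
- by move=> d [].
- by move=> d _; exact: shift_wcat.
- by move=> d [/startsP].
- by move=> d _; exact: prepend_agrees Th.
move=> s [Fs sAC sA _]; exists s; split=> //.
  by apply: supportedS sAC => d [|/CB]; [left|right].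
by move=> d Ad; rewrite sA//; apply: wB; exact: starts_wcat.
Qed.

End Completions.

Theorem corollary6p9 (n : nat) (hn : 1 < n) (T : transducer n)
    (hT : partially_invertible T)
    (hcompl : exists h : homeo (cantor n), completion T h) :
  simple_subgroup (derived (full_group T)).
Proof.
have [h Th] := hcompl; have n0 : 0 < n by exact: ltnW.
apply: full_derived_simple.
- exact: full_group_subgroup.
- exact: full_full_group.
- exact: full_group_compressible Th.
- exact: cantor_zero_dimensional.
- exact: cantor_perfect.
- exact: (fun=> Ordinal n0).
Qed.
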